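(* Let $X\in\mathbb{R}^{n\times m}$ have full column rank, let $k$ be an integer with $m\le k\le n$, and let $1\le\ell\le m$. Let $S_0\subseteq\{1,\dots,n\}$ be a set of size $n_0\ge k$ with $X_{S_0}^\top X_{S_0}\succ0$. The greedy removal algorithm (described in the context) initialized with $S_0$ produces a set $S^+$ of size $k$ such that $$E_\ell\bigl((X_{S^+}^\top X_{S^+})^{-1}\bigr)\le\prod_{j=1}^{\ell}\frac{n_0-m+j}{k-m+j}\cdot E_\ell\bigl((X_{S_0}^\top X_{S_0})^{-1}\bigr).$$
   Context: $X_S$ denotes the $|S|\times m$ matrix formed by the rows of $X$ indexed by $S$. For a symmetric $m\times m$ matrix $M$ with eigenvalues $\lambda_1,\dots,\lambda_m$, $E_\ell(M)=\sum_{I\subseteq\{1,\dots,m\},\,|I|=\ell}\prod_{j\in I}\lambda_j$. For $S$ with $X_S^\top X_S\succ0$ put $f_\ell(S)=\tfrac1\ell\log E_\ell\bigl((X_S^\top X_S)^{-1}\bigr)$. Greedy removal algorithm with input $X$, budget $k$, initial set $S_0$: start with $S=S_0$; while $|S|>k$, find $i\in S$ such that $X_{S\setminus\{i\}}^\top X_{S\setminus\{i\}}\succ0$ and $i$ minimizes $f_\ell(S\setminus\{i\})$ among all such $i$, and replace $S$ by $S\setminus\{i\}$; return $S$. (Ties may be broken arbitrarily.) *)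

(* Defs.v *)
From mathcomp Require Import all_boot all_order all_algebra.
From mathcomp Require Import complex.
From mathcomp Require Import boolp classical_sets reals exp.

Set Implicit Arguments.
Unset Strict Implicit.
Unset Printing Implicit Defensive.

Import Order.TTheory GRing.Theory Num.Theory.
Local Open Scope ring_scope.

(* The eigenvalues are listed with algebraic multiplicity. *)
Definition is_spectrum (R : realType) (m : nat) (M : 'M[R]_m)
    (lam : 'rV[R]_m) : Prop :=
  char_poly M = \prod_(i < m) ('X - (lam 0 i)%:P).

Lemma char_poly_conj (F : fieldType) (m : nat) (P A : 'M[F]_m) :
  P \in unitmx -> char_poly (invmx P *m A *m P) = char_poly A.
Proof.
move=> uP; pose p := map_mx (@polyC F) P; pose q := map_mx (@polyC F) (invmx P).
have qp : q *m p = 1%:M by rewrite -map_mxM mulVmx // map_mx1.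
rewrite /char_poly /char_poly_mx 2!map_mxM -/p -/q.
have -> : 'X%:M - q *m map_mx (@polyC F) A *m p
        = q *m ('X%:M - map_mx (@polyC F) A) *m p.
  by rewrite mulmxBr mulmxBl mul_mx_scalar -scalemxAl qp scalemx1.
by rewrite !det_mulmx mulrAC -det_mulmx qp det1 mul1r.
Qed.

Lemma sym_has_spectrum (R : realType) (m : nat) (M : 'M[R]_m) :
  M^T = M -> exists lam, is_spectrum M lam.
Proof.
move=> symM.
pose MC : 'M[R[i]]_m := map_mx (real_complex R) M.
have hM : MC \is hermsymmx.
  apply: realsym_hermsym; last first.
    by apply/mxOverP => i j; rewrite mxE; apply/complex_realP; exists (M i j).
  apply/is_hermitianmxP; rewrite expr0 scale1r.
  by apply/matrixP => i j; rewrite !mxE /= -[in LHS]symM mxE.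
have rd := hermitian_spectral_diag_real hM.
have /orthomx_spectralP eM := hermitian_normalmx hM.
exists (map_mx (@complex.Re R) (spectral_diag MC)).
apply: (map_poly_inj (real_complex R)).
rewrite map_char_poly -/MC rmorph_prod /= [in LHS]eM.
rewrite char_poly_conj ?spectral_unit // char_poly_trig ?diag_mx_is_trig //.
apply: eq_bigr => i _; rewrite rmorphB /= map_polyX map_polyC /= !mxE eqxx mulr1n.
by have /mxOverP/(_ 0 i)/complex_realP[x ->] := rd.
Qed.

(* Not characterised unless all the roots of [char_poly M] are real; they are
   for symmetric [M], by [sym_has_spectrum]. *)
Definition eigenvalues (R : realType) (m : nat) (M : 'M[R]_m) : 'rV[R]_m :=
  xget 0 [set lam | is_spectrum M lam]%classic.

Definition Esym (R : realType) (m : nat) (l : nat) (M : 'M[R]_m) : R :=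
  \sum_(I : {set 'I_m} | #|I| == l) \prod_(j in I) eigenvalues M 0 j.

Definition posdef (R : realType) (m : nat) (M : 'M[R]_m) : Prop :=
  M^T = M /\ forall v : 'cV[R]_m, v != 0 -> 0 < (v^T *m M *m v) 0 0.

Definition rows (R : realType) (n m : nat) (X : 'M[R]_(n, m)) (S : {set 'I_n}) :
    'M[R]_(#|S|, m) :=
  rowsub (fun i : 'I_#|S| => enum_val i) X.

Definition gram (R : realType) (n m : nat) (X : 'M[R]_(n, m)) (S : {set 'I_n}) :
    'M[R]_m :=
  (rows X S)^T *m rows X S.

Definition objective (R : realType) (n m : nat) (X : 'M[R]_(n, m)) (l : nat)
    (S : {set 'I_n}) : R :=
  l%:R^-1 * ln (Esym l (invmx (gram X S))).

Definition greedy_choice (R : realType) (n m : nat) (X : 'M[R]_(n, m)) (l : nat)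
    (S : {set 'I_n}) (i : 'I_n) : Prop :=
  [/\ i \in S, posdef (gram X (S :\ i)) &
    forall j : 'I_n, j \in S -> posdef (gram X (S :\ j)) ->
      objective X l (S :\ i) <= objective X l (S :\ j)].

(* One pass through the loop. A relation, since ties are broken arbitrarily. *)
Definition greedy_step (R : realType) (n m : nat) (X : 'M[R]_(n, m)) (k l : nat)
    (S T : {set 'I_n}) : Prop :=
  (k < #|S|)%N /\ exists2 i : 'I_n, greedy_choice X l S i & T = S :\ i.

Inductive greedy_reach (R : realType) (n m : nat) (X : 'M[R]_(n, m)) (k l : nat)
    (S0 : {set 'I_n}) : {set 'I_n} -> Prop :=
| greedy_start : greedy_reach X k l S0 S0
| greedy_next (S T : {set 'I_n}) :
    greedy_reach X k l S0 S -> greedy_step X k l S T -> greedy_reach X k l S0 T.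

(* [S] is returned by some run: it is reached and the loop guard fails. *)
Definition greedy_output (R : realType) (n m : nat) (X : 'M[R]_(n, m))
    (k l : nat) (S0 S : {set 'I_n}) : Prop :=
  greedy_reach X k l S0 S /\ ~ (k < #|S|)%N.

(* Main.v *)
(** Write [Q_S = det('X + X_S^T X_S) = char_poly (- gram X S)]. Removing row [i]
  is a rank-one update, so by the matrix determinant lemma and Jacobi's formula
  [\sum_(i in S) Q_(S \ i) = (|S| - m) Q_S + 'X * Q_S^`()]; hence the
  coefficients of degree [l] of the [Q_(S \ i)] add up to [|S| - m + l] times
  that of [Q_S]. For [S] admissible, [E_l((X_S^T X_S)^-1)] is the quotient of
  the coefficients of [Q_S] of degrees [l] and [0]. Averaging over [i] with
  weights the coefficients of degree [0] (which vanish exactly at the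
  inadmissible [i]), some admissible [i] multiplies [E_l] by at most
  [(|S| - m + l) / (|S| - m)]. The product of these factors telescopes. *)

Require Import Defs.
From mathcomp Require Import all_boot all_order all_algebra.
From mathcomp Require Import boolp classical_sets reals exp.
From mathcomp Require Import ring lra.
Set Implicit Arguments.
Unset Strict Implicit.
Unset Printing Implicit Defensive.
Import Order.TTheory GRing.Theory Num.Theory.
Local Open Scope ring_scope.

(** * Jacobi's formula and rank-one updates of determinants *)

Lemma deriv_bigprod (R : comNzRingType) (I : finType) (F : I -> {poly R}) :
  (\prod_i F i)^`() = \sum_i (F i)^`() * \prod_(j | i != j) F j.
Proof.
suff H (P : pred I) : (\prod_(i | P i) F i)^`() =
   \sum_(i | P i) (F i)^`() * \prod_(j | P j && (i != j)) F j by exact: H.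
elim: {P}_.+1 {-2}P (ltnSn #|P|) => // k IH P leP.
have [i Pi | P0] := pickP P; last first.
  by rewrite !big_pred0 // -[1]/(1%:P) derivC.
rewrite [in LHS](bigD1 i) //= derivM [RHS](bigD1 i) //=; congr (_ + _).
  by congr (_ * _); apply: eq_bigl => j; rewrite eq_sym.
rewrite IH; last first.
  rewrite -ltnS (leq_trans _ leP) // ltnS.
  rewrite [in X in (_ < X)%N](cardD1 i) unfold_in Pi.
  rewrite add1n ltnS; apply/subset_leq_card/fintype.subsetP => j.
  by rewrite !inE /= !unfold_in /= andbC.
rewrite mulr_sumr; apply: eq_bigr => j /andP[Pj ji].
rewrite mulrCA; congr (_ * _); rewrite [RHS](bigD1 i) /=; last by rewrite Pi.
by congr (_ * _); apply: eq_bigl => a; rewrite andbAC.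
Qed.

(** Only diagonal entries of [char_poly_mx A] depend on ['X], so in the Leibniz expansion just the
    permutations fixing [i] survive differentiation of factor [i]; they form the [(i, i)]
    cofactor. *)
Lemma deriv_char_poly (R : comNzRingType) (m : nat) (A : 'M[R]_m) :
  (char_poly A)^`() = \tr (\adj (char_poly_mx A)).
Proof.
rewrite /char_poly /determinant raddf_sum /=.
transitivity (\sum_i cofactor (char_poly_mx A) i i); last first.
  by apply: eq_bigr => i _; rewrite mxE.
under [RHS]eq_bigr => i _ do rewrite expand_cofactor big_mkcond.
rewrite exchange_big /=; apply: eq_bigr => s _.
rewrite -signr_odd -polyC1 -polyCN -rmorphXn /= mul_polyC derivZ.
rewrite deriv_bigprod scaler_sumr.
apply: eq_bigr => i _; rewrite !mxE derivB derivC subr0 eq_sym.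
case: eqP => _; last by rewrite mulr0n linear0 mul0r scaler0.
by rewrite mulr1n derivX mul1r -mul_polyC.
Qed.

(* Both sides are compared with the determinant of the bordered matrix [B]. *)
Lemma det_sub_rank1 (R : idomainType) (m : nat) (A : 'M[R]_m)
    (u : 'cV[R]_m) (v : 'rV[R]_m) : \det A != 0 ->
  \det (A - u *m v) = \det A - (v *m \adj A *m u) 0 0.
Proof.
move=> dA0; pose B := block_mx A u v (1%:M : 'M_1).
have detB : \det (A - u *m v) = \det B.
  have : B *m block_mx 1%:M 0 (- v) 1%:M = block_mx (A - u *m v) u 0 1%:M.
    by rewrite mulmx_block !mulmx1 !mul1mx !mulmx0 !add0r mulmxN addrN.
  move/(congr1 determinant); rewrite det_mulmx det_lblock det_ublock.
  by rewrite !det1 !mulr1.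
(* The column operation below has determinant [\det A], so the identity first appears multiplied by
   it. *)
apply: (mulIf dA0); rewrite detB.
have : B *m block_mx 1%:M (- (\adj A *m u)) 0 (\det A)%:M
    = block_mx A 0 v ((\det A)%:M - v *m \adj A *m u).
  rewrite mulmx_block !mulmx1 !mul1mx !mulmx0 !addr0 !mulmxN mulmxA mul_mx_adj.
  by rewrite mul_scalar_mx mul_mx_scalar addNr mulmxA addrC.
move/(congr1 determinant); rewrite det_mulmx det_lblock det_ublock.
rewrite det1 mul1r !det_mx11 !mxE mulr1n => ->; rewrite mulrC.
by congr (_ * _); rewrite !mxE.
Qed.

(** * Gram matrices under removal of a row *)

Section Gram.
Variables (R : realType) (n m : nat) (X : 'M[R]_(n, m)).
Implicit Types S : {set 'I_n}.

Lemma gram_sum S : gram X S = \sum_(i in S) (row i X)^T *m row i X.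
Proof.
apply/matrixP => a b; rewrite summxE mxE [RHS]big_enum_val /=.
by apply: eq_bigr => i _; rewrite !mxE big_ord1 !mxE.
Qed.

Lemma gram_setD1 S i : i \in S ->
  gram X (S :\ i) = gram X S - (row i X)^T *m row i X.
Proof.
by move=> iS; rewrite !gram_sum (big_setD1 i iS) /= addrAC subrr add0r.
Qed.

Lemma gram_tr S : (gram X S)^T = gram X S.
Proof. by rewrite trmx_mul trmxK. Qed.

Lemma gram_form_ge0 S (v : 'cV[R]_m) : 0 <= (v^T *m gram X S *m v) 0 0.
Proof.
rewrite mulmxA -mulmxA -trmx_mul mxE; apply: sumr_ge0 => i _.
by rewrite mxE -expr2 sqr_ge0.
Qed.

Lemma gram_form_eq0 S (v : 'cV[R]_m) :
  (v^T *m gram X S *m v) 0 0 = 0 -> gram X S *m v = 0.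
Proof.
rewrite mulmxA -mulmxA -trmx_mul mxE => /eqP.
rewrite psumr_eq0 => [/allP H|i _]; last by rewrite mxE -expr2 sqr_ge0.
suff -> : gram X S *m v = (rows X S)^T *m 0 by rewrite mulmx0.
rewrite -mulmxA; congr (_ *m _); apply/matrixP => i j; rewrite ord1 [RHS]mxE.
have /implyP/(_ isT) := H i (mem_index_enum i).
by rewrite mxE mulf_eq0 orbb => /eqP.
Qed.

(** The form is the squared norm of [rows X S *m v], so definiteness can fail only through a kernel
    vector. *)
Lemma posdef_gramP S : posdef (gram X S) <-> \det (gram X S) != 0.
Proof.
split=> [[_ pd]|d0].
  rewrite -det_tr; apply/det0P => -[v v0 vG]; have := pd v^T.
  rewrite trmx_eq0 trmxK => /(_ v0).
  by rewrite -[gram X S]gram_tr vG mul0mx mxE ltxx.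
split=> [|v v0]; first exact: gram_tr.
rewrite lt_neqAle gram_form_ge0 andbT eq_sym; apply/eqP => /gram_form_eq0 Gv.
move: d0; rewrite -det_tr => /det0P[]; exists v^T; first by rewrite trmx_eq0.
by rewrite -trmx_mul Gv trmx0.
Qed.

Lemma sum_char_poly_gram S :
  \sum_(i in S) char_poly (- gram X (S :\ i))
    = char_poly (- gram X S) *+ #|S| - char_poly (- gram X S) *+ m
      + 'X * (char_poly (- gram X S))^`().
Proof.
pose A := char_poly_mx (- gram X S).
(* Over polynomials the determinant is monic, so the rank-one formula applies even if [gram X S] is
   singular. *)
have dA0 : \det A != 0 by rewrite monic_neq0 // char_poly_monic.
pose r i : 'rV[{poly R}]_m := map_mx polyC (row i X).
have step i : i \in S ->
    char_poly (- gram X (S :\ i)) = \det A - \tr (\adj A *m ((r i)^T *m r i)).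
  move=> iS; rewrite mulmxA mxtrace_mulC mulmxA trace_mx11 -det_sub_rank1 //.
  rewrite /char_poly; congr (\det _).
  rewrite /A /char_poly_mx gram_setD1 // opprB map_mxB map_mxM map_mxN map_trmx.
  by rewrite opprB opprK addrA.
rewrite (eq_bigr _ step) sumrB sumr_const -linear_sum -mulmx_sumr /=.
rewrite -addrA; congr (_ + _).
(* The rank-one terms add up to [A - 'X%:M]. Against [\adj A] its trace is [m] times [\det A] minus
   ['X] times the trace of [\adj A], which is the derivative. *)
have -> : \sum_(i in S) (r i)^T *m r i = A - 'X%:M.
  rewrite /A /char_poly_mx map_mxN opprK addrC addKr gram_sum.
  rewrite raddf_sum /=; apply: eq_bigr => i _.
  by rewrite map_mxM map_trmx.
rewrite mulmxBr mul_adj_mx mul_mx_scalar linearB /= mxtrace_scalar.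
by rewrite mxtraceZ -deriv_char_poly opprB addrC.
Qed.
End Gram.

(** * Spectra and coefficients of characteristic polynomials *)

Lemma horner_char_poly (R : comNzRingType) (m : nat) (A : 'M[R]_m) (t : R) :
  (char_poly A).[t] = \det (t%:M - A).
Proof.
rewrite -horner_evalE -det_map_mx; congr (\det _).
apply/matrixP => i j; rewrite !mxE rmorphB rmorphMn /=.
by rewrite !horner_evalE hornerX hornerC.
Qed.

Lemma poly_ext_neq0 (R : numDomainType) (p q : {poly R}) :
  (forall t, t != 0 -> p.[t] = q.[t]) -> p = q.
Proof.
move=> pq; apply/eqP; rewrite -subr_eq0; apply/eqP.
(* In characteristic zero the points 1, 2, ... are distinct and nonzero, and there are enough of
   them to kill the difference. *)
pose s := [seq k.+1%:R : R | k <- iota 0 (size (p - q))].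
apply: (@roots_geq_poly_eq0 _ _ s); last by rewrite size_map size_iota.
  apply/allP => _ /mapP[k _ ->]; rewrite /root hornerD hornerN pq ?subrr //.
  by rewrite pnatr_eq0.
rewrite map_inj_uniq ?iota_uniq // => a b /eqP.
by rewrite eqr_nat eqSS => /eqP.
Qed.

Section Spectrum.
Variables (R : realType) (m : nat).
Implicit Types (M : 'M[R]_m) (lam : 'rV[R]_m).

Lemma eigenvaluesP M : M^T = M -> is_spectrum M (eigenvalues M).
Proof. by move/sym_has_spectrum => ex; apply: (xgetPex _ ex). Qed.

Lemma det_spectrum M lam : is_spectrum M lam -> \det M = \prod_i lam 0 i.
Proof.
move=> sp; have := horner_char_poly M 0; rewrite sp horner_prod.
rewrite raddf0 sub0r -scaleN1r detZ => /(congr1 ( *%R ((-1) ^+ m))).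
rewrite mulrA -expr2 sqrr_sign mul1r => <-.
rewrite -[X in _ ^+ X]card_ord -prodr_const -big_split /=.
by apply: eq_bigr => i _; rewrite hornerXsubC sub0r mulN1r opprK.
Qed.

(** For nonzero [t], [\det M * \det (t%:M - invmx M)] equals [\det (t *: M - 1%:M)], which is
    [(- t) ^+ m] times [char_poly M] at [t^-1]. This keeps multiplicities. *)
Lemma spectrum_inv M lam : M \in unitmx -> is_spectrum M lam ->
  is_spectrum (invmx M) (map_mx GRing.inv lam).
Proof.
move=> uM sp; have dM := det_spectrum sp.
have d0 : \det M != 0 by rewrite -unitfE -unitmxE.
have lam0 i : lam 0 i != 0.
  by apply: contraNneq d0 => e; rewrite dM (bigD1 i) //= e mul0r.
apply: poly_ext_neq0 => t t0; apply: (mulfI d0).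
rewrite horner_char_poly -det_mulmx mulmxBr mul_mx_scalar mulmxV //.
have -> : t *: M - 1%:M = (- t) *: (t^-1%:M - M).
  rewrite scalerBr scale_scalar_mx mulNr divff // !scaleNr opprK addrC.
  by rewrite raddfN.
rewrite detZ -horner_char_poly sp dM !horner_prod -big_split /=.
rewrite -[X in _ ^+ X]card_ord -prodr_const -big_split /=.
apply: eq_bigr => i _; rewrite !hornerXsubC mxE; field.
by rewrite t0 lam0.
Qed.

Lemma char_polyN_spectrum M lam : is_spectrum M lam ->
  char_poly (- M) = \prod_i ('X + (lam 0 i)%:P).
Proof.
move=> sp; apply: poly_ext_neq0 => t _; rewrite horner_char_poly.
have -> : t%:M - - M = (-1) *: ((- t)%:M - M).
  by rewrite scalerBr scale_scalar_mx mulN1r scaleN1r !opprK.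
rewrite detZ -horner_char_poly sp !horner_prod.
rewrite -[X in _ ^+ X]card_ord -prodr_const -big_split /=.
apply: eq_bigr => i _; rewrite !hornerE; ring.
Qed.

(** Expanding the product of the ['X + lam_i], [J] is the set of factors contributing ['X]. *)
Lemma coef_char_polyN M lam k : is_spectrum M lam ->
  (char_poly (- M))`_k
    = \sum_(J : {set 'I_m} | #|J| == k) \prod_(i in ~: J) lam 0 i.
Proof.
move/char_polyN_spectrum ->; rewrite bigA_distr coef_sum [RHS]big_mkcond /=.
apply: eq_bigr => J _.
have -> : \prod_i (if i \in J then 'X else (lam 0 i)%:P)
   = 'X^#|J| * (\prod_(i in ~: J) lam 0 i)%:P :> {poly R}.
  rewrite (bigID (mem J)) /=; congr (_ * _).
    by rewrite -prodr_const; apply: eq_bigr => i ->.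
  rewrite rmorph_prod; apply: eq_big => i; first by rewrite inE.
  by move=> /negPf ->.
by rewrite coefMC coefXn eq_sym; case: eqP; rewrite ?mul1r ?mul0r.
Qed.

Lemma coef0_char_polyN M : (char_poly (- M))`_0 = \det M.
Proof.
by rewrite char_poly_det -[- M]scaleN1r detZ mulrA -expr2 sqrr_sign mul1r.
Qed.

Lemma Esym_inv l M : M^T = M -> \det M != 0 ->
  Esym l (invmx M) = (char_poly (- M))`_l / \det M.
Proof.
move=> sM d0; have uM : M \in unitmx by rewrite unitmxE unitfE.
have sp : is_spectrum (invmx M) (eigenvalues (invmx M)).
  by apply: eigenvaluesP; rewrite trmx_inv sM.
have dM := det_spectrum sp; rewrite det_inv in dM.
(* [eigenvalues] chooses an ordering for each matrix separately, so the spectrum of [M] is taken to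
   be the reciprocals of the one chosen for [invmx M]. *)
have := spectrum_inv _ sp; rewrite invmxK unitmx_inv => /(_ uM) spM.
rewrite (coef_char_polyN _ spM) mulr_suml; apply: eq_bigr => J _.
have -> : (\det M)^-1 = \prod_(i in J) eigenvalues (invmx M) 0 i
                      * \prod_(i in ~: J) eigenvalues (invmx M) 0 i.
  rewrite dM (bigID (mem J)) /=; congr (_ * _).
  by apply: eq_bigl => i; rewrite inE.
rewrite mulrCA -[LHS]mulr1; congr (_ * _).
rewrite -big_split big1 //= => i _; rewrite mxE mulVf //.
apply: contraNneq d0 => e; rewrite -invr_eq0 dM.
by rewrite (bigD1 i) //= e mul0r.
Qed.
End Spectrum.

(** * Positivity of the coefficients and the bound for one removal *)

Section GramSpectrum.
Variables (R : realType) (n m : nat) (X : 'M[R]_(n, m)).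
Implicit Types S : {set 'I_n}.

(** An eigenvector [v] makes the nonnegative form equal to the eigenvalue times the squared norm of
    [v]. *)
Lemma gram_spectrum_ge0 S lam i : is_spectrum (gram X S) lam -> 0 <= lam 0 i.
Proof.
move=> sp; have /eigenvalueP[v vG v0] : eigenvalue (gram X S) (lam 0 i).
  rewrite eigenvalue_root_char sp /root horner_prod (bigD1 i) //=.
  by rewrite hornerXsubC subrr mul0r.
have := gram_form_ge0 X S v^T; rewrite trmxK vG -scalemxAl mxE.
rewrite pmulr_lge0 // mxE lt_neqAle sumr_ge0 => [|j _]; last first.
  by rewrite mxE -expr2 sqr_ge0.
rewrite andbT eq_sym; apply: contra_neq v0 => e; apply/rowP => j; rewrite mxE.
have /psumr_eq0P : \sum_j v 0 j ^+ 2 = 0.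
  by rewrite -[RHS]e; apply: eq_bigr => k _; rewrite mxE.
by move=> /(_ (fun k _ => sqr_ge0 _) j isT)/eqP; rewrite sqrf_eq0 => /eqP.
Qed.

Lemma coef_gram_ge0 S k : 0 <= (char_poly (- gram X S))`_k.
Proof.
have sp := eigenvaluesP (gram_tr X S).
rewrite (coef_char_polyN _ sp); apply: sumr_ge0 => J _.
by apply: prodr_ge0 => i _; apply: gram_spectrum_ge0 sp.
Qed.

Lemma coef_gram_gt0 S k : posdef (gram X S) -> (k <= m)%N ->
  0 < (char_poly (- gram X S))`_k.
Proof.
move=> /posdef_gramP d0 km.
have sp := eigenvaluesP (gram_tr X S).
have gt0 i : 0 < eigenvalues (gram X S) 0 i.
  rewrite lt_neqAle (gram_spectrum_ge0 _ sp) andbT eq_sym.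
  apply: contraNneq d0 => e.
  by rewrite (det_spectrum sp) (bigD1 i) //= e mul0r.
rewrite (coef_char_polyN _ sp).
(* Since [k <= m], the sum has at least one term, and all its terms are positive. *)
have /card_gt0P[J] : (0 < #|[set J : {set 'I_m} | #|J| == k]|)%N.
  by rewrite card_draws card_ord bin_gt0.
rewrite inE => Jk; rewrite (bigD1 J) //=; apply: ltr_wpDr.
  by apply: sumr_ge0 => K _; apply: prodr_ge0 => i _; apply: ltW.
by apply: prodr_gt0.
Qed.

Lemma det_gram_gt0 S : posdef (gram X S) -> 0 < \det (gram X S).
Proof. by move=> pd; rewrite -coef0_char_polyN coef_gram_gt0. Qed.

Lemma Esym_gram S l : posdef (gram X S) ->
  Esym l (invmx (gram X S))
    = (char_poly (- gram X S))`_l / (char_poly (- gram X S))`_0.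
Proof.
move=> pd; rewrite coef0_char_polyN Esym_inv ?gram_tr //.
by rewrite gt_eqF ?det_gram_gt0.
Qed.

Lemma Esym_gram_gt0 S l : posdef (gram X S) -> (l <= m)%N ->
  0 < Esym l (invmx (gram X S)).
Proof. by move=> pd lm; rewrite Esym_gram // divr_gt0 ?coef_gram_gt0. Qed.

Lemma sum_coef_gram S l :
  \sum_(i in S) (char_poly (- gram X (S :\ i)))`_l
    = (#|S|%:R - m%:R + l%:R) * (char_poly (- gram X S))`_l.
Proof.
rewrite -coef_sum sum_char_poly_gram coefD coefB !coefMn coefXM coef_deriv.
rewrite !mulrDl mulNr !mulr_natl; congr (_ + _).
by case: l.
Qed.

(** The determinants after one removal add up to [#|S| - m] times [\det (gram X S)], so they cannot
    all vanish. *)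
Lemma exists_posdef_setD1 S : posdef (gram X S) -> (m < #|S|)%N ->
  exists2 i, i \in S & posdef (gram X (S :\ i)).
Proof.
move=> pd mS; have := sum_coef_gram S 0; rewrite addr0 => e.
have : 0 < \sum_(i in S) (char_poly (- gram X (S :\ i)))`_0.
  by rewrite e mulr_gt0 ?coef_gram_gt0 // subr_gt0 ltr_nat.
rewrite lt_neqAle => /andP[]; rewrite eq_sym => /eqP s0 _.
apply: contrapT => no; apply: s0; apply: big1 => i iS.
apply/eqP; apply: contrapT => /negP; rewrite coef0_char_polyN => d0.
by apply: no; exists i => //; apply/posdef_gramP.
Qed.

Lemma exists_greedy_choice S l : posdef (gram X S) -> (m < #|S|)%N ->
  exists i, greedy_choice X l S i.
Proof.
move=> pd mS; have [i0 i0S pd0] := exists_posdef_setD1 pd mS.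
pose P := [pred i | (i \in S) && `[< posdef (gram X (S :\ i)) >]].
have Pi0 : P i0 by rewrite inE i0S; apply/asboolP.
have [i /andP[iS /asboolP pdi] mini] :=
  @Order.TotalTheory.arg_minP _ _ _ _ _ (fun i => objective X l (S :\ i)) Pi0.
exists i; split; [exact: iS | exact: pdi | move=> j jS pdj].
have Pj : P j by rewrite inE jS; apply/asboolP.
exact: mini j Pj.
Qed.

Lemma greedy_choice_bound S i l :
  (1 <= l <= m)%N -> posdef (gram X S) -> (m < #|S|)%N ->
  greedy_choice X l S i ->
  Esym l (invmx (gram X (S :\ i)))
    <= (#|S|%:R - m%:R + l%:R) / (#|S|%:R - m%:R) * Esym l (invmx (gram X S)).
Proof.
move=> /andP[l1 lm] pd mS [iS pdi mini].
set rho := Esym l (invmx (gram X (S :\ i))).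
have sm0 : 0 < #|S|%:R - m%:R :> R by rewrite subr_gt0 ltr_nat.
have Q0 := coef_gram_gt0 pd (leq0n m).
rewrite (Esym_gram l pd) mulrACA -invfM ler_pdivlMr ?mulr_gt0 //.
(* With denominators cleared, the sum identity in degrees [l] and 0 turns both sides into sums over
   the removed row, compared term by term. *)
rewrite -sum_coef_gram -[#|S|%:R - _]addr0 -[0]/(0%:R) -sum_coef_gram mulr_sumr.
apply: ler_sum => j jS.
have [pdj|npd] := pselect (posdef (gram X (S :\ j))); last first.
  (* An inadmissible [j] has weight zero on the left and a nonnegative coefficient on the right. *)
  suff -> : (char_poly (- gram X (S :\ j)))`_0 = 0.
    by rewrite mulr0 coef_gram_ge0.
  rewrite coef0_char_polyN; apply/eqP; apply: contrapT => /negP d0.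
  by apply: npd; apply/posdef_gramP.
rewrite -ler_pdivlMr ?coef_gram_gt0 // -Esym_gram //.
(* As [l >= 1] and both values of [Esym] are positive, comparing objectives amounts to comparing
   [Esym]. *)
have := mini j jS pdj; rewrite ler_pM2l ?invr_gt0 ?ltr0n //.
by rewrite ler_ln // posrE Esym_gram_gt0.
Qed.
End GramSpectrum.

(** * Telescoping along a run of the algorithm *)

(** The ratios [(x + 1 + j) / (x + j)] telescope over [j] to the one-step factor. Here [x] stands
    for the size after removal minus [m], possibly 0, and [y] for the fixed numerators. *)
Lemma prod_ratio_step (F : realFieldType) (y : nat -> F) (x : F) (l : nat) :
  0 <= x ->
  (x + 1 + l%:R) / (x + 1) * \prod_(1 <= j < l.+1) (y j / (x + 1 + j%:R))
    = \prod_(1 <= j < l.+1) (y j / (x + j%:R)).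
Proof.
move=> x0; elim: l => [|l IH].
  by rewrite !big_geq // mulr1 addr0 divff // gt_eqF // ltr_wpDl.
rewrite [RHS]big_nat_recr //= -IH big_nat_recr //= -!natr1.
have l0 := ler0n F l; field.
by rewrite !gt_eqF //; lra.
Qed.

Section Greedy.
Variables (R : realType) (n m : nat) (X : 'M[R]_(n, m)) (k l : nat).
Variable S0 : {set 'I_n}.
Hypotheses (mk : (m <= k)%N) (l_bounds : (1 <= l <= m)%N).
Hypothesis kS0 : (k <= #|S0|)%N.
Hypothesis posdefS0 : posdef (gram X S0).

(** Loop invariant: the final bound with the current size in place of [k]. It starts with product 1,
    and each removal shifts the denominators by one. *)
Lemma greedy_reach_bound S : greedy_reach X k l S0 S ->
  [/\ posdef (gram X S), (k <= #|S|)%N &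
    Esym l (invmx (gram X S)) <=
      (\prod_(1 <= j < l.+1)
         ((#|S0|%:R - m%:R + j%:R) / (#|S|%:R - m%:R + j%:R)))
      * Esym l (invmx (gram X S0))].
Proof.
elim=> [|T _ _ [pd _ bnd] [kT [i ch ->]]].
  split=> //; rewrite big_nat big1 ?mul1r // => j /andP[j1 _].
  rewrite divff // gt_eqF // ltr_wpDl ?ltr0n // subr_ge0 ler_nat.
  exact: leq_trans kS0.
have mT : (m < #|T|)%N := leq_ltn_trans mk kT.
have [iS pdi _] := ch.
have cT : #|T| = #|T :\ i|.+1 by rewrite (cardsD1 i) iS.
split=> //; first by rewrite -ltnS -cT.
apply: le_trans (greedy_choice_bound l_bounds pd mT ch) _.
have x0 : 0 <= #|T :\ i|%:R - m%:R :> R by rewrite subr_ge0 ler_nat -ltnS -cT.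
have e : #|T|%:R - m%:R = #|T :\ i|%:R - m%:R + 1 :> R.
  by rewrite cT -natr1 addrAC.
rewrite -(prod_ratio_step _ l x0) -[leRHS]mulrA; move: bnd; rewrite e => bnd.
apply: ler_wpM2l bnd.
have x1 := addr_ge0 x0 ler01.
by apply: divr_ge0 => //; apply: addr_ge0 => //; apply: ler0n.
Qed.

Lemma greedy_step_exists S : greedy_reach X k l S0 S -> (k < #|S|)%N ->
  exists T, greedy_step X k l S T.
Proof.
move=> /greedy_reach_bound[pd _ _] kS.
have [i ch] := exists_greedy_choice l pd (leq_ltn_trans mk kS).
by exists (S :\ i); split => //; exists i.
Qed.

Lemma greedy_output_exists : exists S, greedy_output X k l S0 S.
Proof.
(* Induction on a bound [c] for the current size, which drops by one at each step. *)
suff H c S : greedy_reach X k l S0 S -> (#|S| <= c)%N ->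
    exists T, greedy_output X k l S0 T.
  exact: H (greedy_start X k l S0) (leqnn _).
elim: c S => [|c IH] S rS cS.
  by exists S; split=> //; rewrite ltnNge (leq_trans cS).
have [kS|] := boolP (k < #|S|)%N; last by exists S; split=> //; apply/negP.
have [T st] := greedy_step_exists rS kS.
apply: (IH T); first exact: greedy_next st.
case: st => _ [i [iS _ _] ->].
by rewrite -ltnS (leq_trans _ cS) // [X in (_ < X)%N](cardsD1 i) iS.
Qed.
End Greedy.

(* The first two conclusions say that the algorithm is never stuck, whatever
   the tie-breaking, and that it terminates with an output. *)
Theorem theorem4p3 (R : realType) (n m : nat) (X : 'M[R]_(n, m)) (k l n0 : nat)
    (S0 : {set 'I_n}) :
  \rank X = m ->
  (m <= k <= n)%N ->
  (1 <= l <= m)%N ->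
  #|S0| = n0 ->
  (k <= n0)%N ->
  posdef (gram X S0) ->
  [/\ forall S : {set 'I_n}, greedy_reach X k l S0 S -> (k < #|S|)%N ->
        exists T : {set 'I_n}, greedy_step X k l S T,
      exists S : {set 'I_n}, greedy_output X k l S0 S &
      forall Splus : {set 'I_n}, greedy_output X k l S0 Splus ->
        #|Splus| = k /\
        Esym l (invmx (gram X Splus)) <=
          (\prod_(1 <= j < l.+1)
             ((n0%:R - m%:R + j%:R) / (k%:R - m%:R + j%:R)))
          * Esym l (invmx (gram X S0))].
Proof.
move=> _ /andP[mk _] l_bounds <- kS0 pd0; split.
- by move=> S; apply: greedy_step_exists.
- exact: greedy_output_exists.
move=> S [rS /negP]; rewrite -leqNgt => Sk.
have [_ kS bnd] := greedy_reach_bound mk l_bounds kS0 pd0 rS.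
(* The failed guard gives [#|S| <= k]; the invariant gives the converse. *)
have -> : k = #|S| by apply/eqP; rewrite eqn_leq kS.
by split.
Qed.
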